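(* A contact pseudo-metric manifold $(M,\varphi,\xi,\eta,g)$ is a Sasakian pseudo-metric manifold if and only if the corresponding nondegenerate almost $CR$ structure $(\mathcal{H}(M),J)$, given by $\mathcal{H}(M)=\mathrm{Ker}\,\eta$ and $J=\varphi|_{\mathcal{H}(M)}$, is integrable and $\breve\nabla_\xi J=0$, where $\breve\nabla$ is the Bott partial connection on $\mathcal{H}(M)$ along $\xi$.
   Context: An almost contact pseudo-metric manifold $(M,\varphi,\xi,\eta,g)$ is a smooth connected manifold $M$ of dimension $2n+1$ with a $(1,1)$ tensor field $\varphi$, a vector field $\xi$, a $1$-form $\eta$ and a pseudo-Riemannian metric $g$ such that $\varphi^2=-I+\eta\otimes\xi$, $\eta(\xi)=1$, $\varphi\xi=0$, $\eta\circ\varphi=0$, and $g(\varphi X,\varphi Y)=g(X,Y)-\varepsilon\eta(X)\eta(Y)$ for all $X,Y$, where $\varepsilon=\pm1$ is a fixed sign; this condition is equivalent to $\eta(X)=\varepsilon g(X,\xi)$ together with $g(\varphi X,Y)=-g(X,\varphi Y)$, and so $g(\xi,\xi)=\varepsilon$. It is a contact pseudo-metric manifold if $d\eta=\Phi$, where $\Phi(X,Y)=g(X,\varphi Y)$ and $d\eta(X,Y)=\frac12\big(X\eta(Y)-Y\eta(X)-\eta([X,Y])\big)$. $\nabla$ is the Levi-Civita connection of $g$. A contact pseudo-metric manifold is a Sasakian pseudo-metric manifold if the almost complex structure $\left(X,f\frac{d}{dt}\right)\mapsto\left(\varphi X-f\xi,\eta(X)\frac{d}{dt}\right)$ on $M\times\mathbb{R}$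 is integrable, where $X\in TM$, $t$ is the coordinate on $\mathbb{R}$ and $f$ is a $C^\infty$ function on $M\times\mathbb{R}$; it is well known that this is equivalent to $(\nabla_X\varphi)Y=g(X,Y)\xi-\varepsilon\eta(Y)X$ for all $X,Y$. An almost $CR$ structure on a $(2n+1)$-dimensional manifold $M$ is a pair $(\mathcal{H}(M),J)$, where $\mathcal{H}(M)$ is a smooth real subbundle of rank $2n$ of $TM$ and $J:\mathcal{H}(M)\to\mathcal{H}(M)$ is a smooth bundle isomorphism with $J^2=-I$. It is integrable if for all sections $X,Y$ of $\mathcal{H}(M)$: $[JX,Y]+[X,JY]\in\mathcal{H}(M)$ and $J([JX,Y]+[X,JY])=[JX,JY]-[X,Y]$. For a contact pseudo-metric manifold, with $\theta=-\eta$, the corresponding almost $CR$ structure is nondegenerate, meaning that the Levi form $L_\theta(X,Y)=d\theta(X,JY)$ on $\mathcal{H}(M)$ is a nondegenerate Hermitian form ($L_\theta(JX,JY)=L_\theta(X,Y)$). The Bott partial connection along $\xi$ is defined on sections $X$ of $\mathcal{H}(M)$ by $\breve\nabla_\xi X=(\pounds_\xi X)_{|\mathcal{H}(M)}=[\xi,X]_{|\mathcal{H}(M)}$, where $Y_{|\mathcal{H}(M)}$ denotes the $g$-orthogonal projection of $Y\in TM$ onto $\mathcal{H}(M)$, and $(\breve\nabla_\xi J)X=\breve\nabla_\xi(JX)-J(\breve\nabla_\xi X)$. *)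

(* Defs.v *)
From HB Require Import structures.
From mathcomp Require Import all_boot all_order all_algebra.
From mathcomp Require Import all_classical all_reals all_analysis.

Set Implicit Arguments.
Unset Strict Implicit.
Unset Printing Implicit Defensive.

Import Order.TTheory GRing.Theory Num.Theory.
Import numFieldNormedType.Exports.

Local Open Scope classical_set_scope.
Local Open Scope ring_scope.

(** * Smooth manifolds *)

Fixpoint Ck (R : realType) (m k : nat) (U : set 'rV[R]_m) (f : 'rV[R]_m -> R)
    : Prop :=
  (forall x, U x -> {for x, continuous f}) /\
  if k is k'.+1 then
    forall j : 'I_m,
      (forall x, U x -> derivable f x (delta_mx 0 j)) /\
      Ck k' U (fun x => 'D_(delta_mx 0 j) f x)
  else True.

Definition Cinfty (R : realType) (m : nat) (U : set 'rV[R]_m)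
  (f : 'rV[R]_m -> R) : Prop := forall k, Ck k U f.

(* [coord c] only matters on [dom c], and [cinv c] on [coord c @` dom c]. *)
Record atlas (R : realType) (M : Type) (m : nat) := Atlas {
  chart : Type;
  dom : chart -> set M;
  coord : chart -> M -> 'rV[R]_m;
  cinv : chart -> 'rV[R]_m -> M
}.
Arguments dom {R M m a} c.
Arguments coord {R M m a} c p.
Arguments cinv {R M m a} c x.

Record smooth_manifold (R : realType) (M : topologicalType) (m : nat)
    (A : atlas R M m) : Prop := SmoothManifold {
  sm_hausdorff : hausdorff_space M;
  sm_second_countable : @second_countable M;
  sm_cover : forall p : M, exists c : chart A, dom c p;
  sm_open_dom : forall c : chart A, open (dom c);
  sm_open_img : forall c : chart A, open (coord c @` dom c);
  sm_coordK : forall (c : chart A) p, dom c p -> cinv c (coord c p) = p;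
  sm_coord_cont : forall (c : chart A) p, dom c p ->
    {for p, continuous (coord c)};
  sm_cinv_cont : forall (c : chart A) x, (coord c @` dom c) x ->
    {for x, continuous (cinv c)};
  sm_transition : forall (c d : chart A) (k : 'I_m),
    Cinfty (coord c @` (dom c `&` dom d)) (fun x => coord d (cinv c x) 0 k)
}.

(** * Tensor fields and their calculus

    A tangent vector is given by its row of components in each chart, a tensor
    field by its components in each chart, as functions of the point of [M];
    components in the chart [c] are meaningful at the points of [dom c] only.
    Rows multiply on the left: the endomorphism with matrix [F] is
    [v |-> v *m F], the 1-form with column [a] is [v |-> v *m a]. *)

Section Calculus.
Variables (R : realType) (M : Type) (m : nat) (A : atlas R M m).

Definition vcomp := chart A -> M -> 'rV[R]_m.
Definition fcomp := chart A -> M -> 'cV[R]_m.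
Definition mcomp := chart A -> M -> 'M[R]_m.

Definition smooth_in (c : chart A) (f : M -> R) : Prop :=
  Cinfty (coord c @` dom c) (f \o cinv c).

(* the partial derivative of f with respect to the j-th coordinate of c *)
Definition pd (c : chart A) (j : 'I_m) (f : M -> R) (p : M) : R :=
  'D_(delta_mx 0 j) (f \o cinv c) (coord c p).

(* component rows in c are sent to component rows in d *)
Definition jac (c d : chart A) (p : M) : 'M[R]_m :=
  \matrix_(j, k) pd c j (fun q => coord d q 0 k) p.

Definition vector_field (X : vcomp) : Prop :=
  (forall c j, smooth_in c (fun p => X c p 0 j)) /\
  (forall c d p, dom c p -> dom d p -> X d p = X c p *m jac c d p).

Definition one_form (a : fcomp) : Prop :=
  (forall c j, smooth_in c (fun p => a c p j 0)) /\
  (forall c d p, dom c p -> dom d p -> a c p = jac c d p *m a d p).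

Definition endo_field (F : mcomp) : Prop :=
  (forall c i j, smooth_in c (fun p => F c p i j)) /\
  (forall c d p, dom c p -> dom d p -> F c p *m jac c d p = jac c d p *m F d p).

Definition bilinear_field (g : mcomp) : Prop :=
  (forall c i j, smooth_in c (fun p => g c p i j)) /\
  (forall c d p, dom c p -> dom d p ->
     g c p = jac c d p *m g d p *m (jac c d p)^T).

Definition appl (a : 'cV[R]_m) (v : 'rV[R]_m) : R := (v *m a) 0 0.

Definition form (G : 'M[R]_m) (v w : 'rV[R]_m) : R := (v *m G *m w^T) 0 0.

Definition app_endo (F : mcomp) (X : vcomp) : vcomp :=
  fun c p => X c p *m F c p.

(* the derivative X f of a function f, computed in the chart c *)
Definition dirder (X : vcomp) (c : chart A) (f : M -> R) (p : M) : R :=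
  \sum_j X c p 0 j * pd c j f p.

(* The components in c of [X, Y]; for vector fields X and Y these are related by
   [jac] on overlaps, so that any chart around p can be used at p. *)
Definition lie (X Y : vcomp) : vcomp := fun c p =>
  \row_k (dirder X c (fun q => Y c q 0 k) p - dirder Y c (fun q => X c q 0 k) p).

(* normalised with the factor 1/2 *)
Definition ext_d (a : fcomp) (X Y : vcomp) (c : chart A) (p : M) : R :=
  2^-1 * (dirder X c (fun q => appl (a c q) (Y c q)) p
        - dirder Y c (fun q => appl (a c q) (X c q)) p
        - appl (a c p) (lie X Y c p)).

Definition nijenhuis (F : mcomp) (X Y : vcomp) : vcomp := fun c p =>
  lie (app_endo F X) (app_endo F Y) c p
  + app_endo F (app_endo F (lie X Y)) c p
  - app_endo F (lie (app_endo F X) Y) c p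
  - app_endo F (lie X (app_endo F Y)) c p.

(* Integrability of an almost complex structure F in the sense [F, F] = 0, which
   by Newlander-Nirenberg is the existence of local holomorphic charts. *)
Definition integrable_endo (F : mcomp) : Prop :=
  forall X Y, vector_field X -> vector_field Y ->
  forall c p, dom c p -> nijenhuis F X Y c p = 0.

(* No condition on the signature, which is locally constant by continuity. *)
Record pseudo_riemannian (g : mcomp) : Prop := PseudoRiemannian {
  pr_tensor : bilinear_field g;
  pr_sym : forall c p, dom c p ->
    forall v w, form (g c p) v w = form (g c p) w v;
  pr_nondeg : forall c p, dom c p ->
    forall v, (forall w, form (g c p) v w = 0) -> v = 0
}.

Record almost_contact_pseudo_metric (eps : R) (phi : mcomp) (xi : vcomp)
    (eta : fcomp) (g : mcomp) : Prop := AlmostContactPseudoMetric {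
  ac_eps : eps = 1 \/ eps = -1;
  ac_phi : endo_field phi;
  ac_xi : vector_field xi;
  ac_eta : one_form eta;
  ac_g : pseudo_riemannian g;
  ac_phi2 : forall c p, dom c p -> forall v,
    v *m phi c p *m phi c p = - v + appl (eta c p) v *: xi c p;
  ac_eta_xi : forall c p, dom c p -> appl (eta c p) (xi c p) = 1;
  ac_phi_xi : forall c p, dom c p -> xi c p *m phi c p = 0;
  ac_eta_phi : forall c p, dom c p -> forall v,
    appl (eta c p) (v *m phi c p) = 0;
  ac_compat : forall c p, dom c p -> forall v w,
    form (g c p) (v *m phi c p) (w *m phi c p)
    = form (g c p) v w - eps * appl (eta c p) v * appl (eta c p) w
}.

Record contact_pseudo_metric (eps : R) (phi : mcomp) (xi : vcomp)
    (eta : fcomp) (g : mcomp) : Prop := ContactPseudoMetric {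
  cm_almost : almost_contact_pseudo_metric eps phi xi eta g;
  cm_contact : forall X Y, vector_field X -> vector_field Y ->
    forall c p, dom c p ->
    ext_d eta X Y c p = form (g c p) (X c p) (Y c p *m phi c p)
}.

(** * Almost CR structures

    [H c p] is the set of components in [c] of the vectors of the fibre at [p]
    of the bundle. A bundle map of [H] is given by a field of endomorphisms, of
    which only the restriction to [H] is used. *)

Definition distribution := chart A -> M -> set 'rV[R]_m.

Definition section_of (H : distribution) (X : vcomp) : Prop :=
  vector_field X /\ forall c p, dom c p -> H c p (X c p).

Definition CR_integrable (H : distribution) (J : mcomp) : Prop :=
  forall X Y, section_of H X -> section_of H Y ->
  forall c p, dom c p ->
    let Z := lie (app_endo J X) Y c p + lie X (app_endo J Y) c p in
    H c p Z /\
    Z *m J c p = lie (app_endo J X) (app_endo J Y) c p - lie X Y c p.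

Definition ker_form (eta : fcomp) : distribution :=
  fun c p => [set v | appl (eta c p) v = 0].

(* well defined as soon as G is nondegenerate on H *)
Definition orth_proj (G : 'M[R]_m) (H : set 'rV[R]_m) (v : 'rV[R]_m)
    : 'rV[R]_m :=
  xget 0 [set z | H z /\ forall w, H w -> form G (v - z) w = 0].

(* the Bott partial connection of H along xi *)
Definition bott (g : mcomp) (H : distribution) (xi X : vcomp) : vcomp :=
  fun c p => orth_proj (g c p) (H c p) (lie xi X c p).

Definition bott_parallel (g : mcomp) (H : distribution) (xi : vcomp)
    (J : mcomp) : Prop :=
  forall X, section_of H X -> forall c p, dom c p ->
    bott g H xi (app_endo J X) c p - app_endo J (bott g H xi X) c p = 0.

End Calculus.

(** * The product with the real line *)

(* the charts c x id *)
Definition prodR_atlas (R : realType) (M : Type) (m : nat) (A : atlas R M m)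
    : atlas R (M * R) (m + 1) :=
  @Atlas R (M * R)%type (m + 1) (chart A)
    (fun c => [set q | dom c q.1])
    (fun c q => row_mx (coord c q.1) q.2%:M)
    (fun c x => (cinv c (lsubmx x), rsubmx x 0 0)).

(* in block form, (X, f) *m J = (X *m phi - f *: xi, X *m eta) *)
Definition prodR_J (R : realType) (M : Type) (m : nat) (A : atlas R M m)
    (phi : mcomp A) (xi : vcomp A) (eta : fcomp A) : mcomp (prodR_atlas A) :=
  fun (c : chart A) q =>
    block_mx (phi c q.1) (eta c q.1) (- xi c q.1) 0.

Definition sasakian_pseudo_metric (R : realType) (M : Type) (m : nat)
    (A : atlas R M m) (eps : R) (phi : mcomp A) (xi : vcomp A) (eta : fcomp A)
    (g : mcomp A) : Prop :=
  contact_pseudo_metric eps phi xi eta g /\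
  integrable_endo (prodR_J phi xi eta).

(* Main.v *)
From mathcomp Require Import all_boot all_order all_algebra.
From mathcomp Require Import all_classical all_reals all_analysis.
From mathcomp Require Import ring.
Require Import Defs.

Set Implicit Arguments.
Unset Strict Implicit.
Unset Printing Implicit Defensive.

Import Order.TTheory GRing.Theory Num.Theory.
Import numFieldNormedType.Exports.

Local Open Scope classical_set_scope.
Local Open Scope ring_scope.

(** Write [J] for the almost complex structure [(X, f d/dt) |-> (phi X - f xi,
    eta X d/dt)] on the product of [M] with the line. The manifold is Sasakian
    when the Nijenhuis tensor [N] of [J] vanishes, and [N] is computed on
    generators of the tangent bundle of the product: the sections [X] of
    [H = Ker eta], the field [xi], and [d/dt].

    On a section, [J X = phi X]; moreover [J xi = d/dt] and [J (d/dt) = - xi].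
    Since [d/dt] commutes with the fields of [M], this gives for sections
    [X], [Y] of [H], with [S = [phi X, Y] + [X, phi Y]],
      [N(X, Y) = ([phi X, phi Y] - [X, Y] - phi S, - eta S)],
      [N(X, xi) = ([xi, X] + phi [xi, phi X], eta [xi, phi X])],
      [N(X, d/dt) = ([xi, phi X] - phi [xi, X], - eta [xi, X])],
      [N(xi, d/dt) = 0]
    ([nijenhuis_prodR]). The first expression vanishes exactly when the CR
    structure is integrable. The contact condition gives [eta [xi, X] = 0]
    ([eta_lie_xi]), so that [[xi, X]] is its own projection on [H], and the Bott
    condition says that [[xi, phi X] = phi [xi, X]] ([bott_parallelE]); because
    [phi^2 = -1] on [H] this is also the vanishing of the second and of the
    third expression.

    This settles the direct implication ([integrable_CR_bott]). For the converse
    ([CR_bott_integrable]) one needs that [N] is a tensor, its value at a point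
    depending only on the values of its arguments there ([nijenhuisE]), and that
    any tangent vector occurring as a value of a global field is a combination
    of values of global generators. No bump function is involved: the
    restriction to the slice [M * {t}] of the [M]-component of a field on the
    product is a global field on [M] ([vector_field_slice]), and subtracting its
    [xi]-component turns it into a section of [H] ([vector_fieldB_form]). *)

(** * Functions of class C^k on open sets *)

Section SmoothFunctions.
Variable R : realType.

Lemma Ck_cst (m k : nat) (U : set 'rV[R]_m) (a : R) : Ck k U (cst a).
Proof.
elim: k a => [|k IH] a; split=> //; try by move=> x _; exact: cst_continuous.
move=> j; split; first by move=> x _; exact: derivable_cst.
rewrite (_ : (fun x => _) = cst 0) //; apply/funext => x; exact: derive_cst.
Qed.

(** The difference quotients of [f \o L] and [f] are the same function of the
    increment. *)
Lemma derive_comp_line (V W : normedModType R) (L : V -> W) (f : W -> R) x w v :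
  (forall h : R, L (h *: w + x) = h *: v + L x) ->
  ('D_w (f \o L) x = 'D_v f (L x)) *
  (derivable (f \o L) x w = derivable f (L x) v).
Proof.
move=> Lw; rewrite /derive /derivable.
suff -> : (fun h : R => h^-1 *: ((f \o L \o shift x) (h *: w) - (f \o L) x)) =
          (fun h => h^-1 *: ((f \o shift (L x)) (h *: v) - f (L x))) by [].
by apply/funext => h /=; rewrite Lw.
Qed.

(** A chain rule that needs no total derivative, because [L] carries each
    coordinate direction to a coordinate direction or to zero. It applies to
    the projection from the product with the line and to the inclusion of a
    slice. *)
Lemma Ck_comp_lines (m n : nat) (L : 'rV[R]_m -> 'rV[R]_n) (k : nat)
    (U : set 'rV[R]_m) (V : set 'rV[R]_n) (f : 'rV[R]_n -> R)
    (e : 'I_m -> option 'I_n) :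
  continuous L ->
  (forall j x (h : R), L (h *: delta_mx 0 j + x) =
     h *: (if e j is Some i then delta_mx 0 i else 0) + L x) ->
  (forall x, U x -> V (L x)) -> Ck k V f -> Ck k U (f \o L).
Proof.
move=> cL hL UV; elim: k f => [|k IH] f [cf Df]; split=> //.
- by move=> x /UV Vx; apply: (@continuous_comp _ _ _ L); [exact: cL|exact: cf].
- by move=> x /UV Vx; apply: (@continuous_comp _ _ _ L); [exact: cL|exact: cf].
move=> j; case ej : (e j) => [i|].
  have E x : forall h : R, L (h *: delta_mx 0 j + x) = h *: delta_mx 0 i + L x.
    by move=> h; rewrite hL ej.
  split.
    by move=> x /UV Vx; rewrite (derive_comp_line f (E x)); exact: (Df i).1.
  have -> : (fun x => 'D_(delta_mx 0 j) (f \o L) x) =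
            (fun x => 'D_(delta_mx 0 i) f x) \o L.
    by apply/funext => x; rewrite (derive_comp_line f (E x)).
  exact: IH (Df i).2.
have E x : forall h : R, L (h *: delta_mx 0 j + x) = h *: 0 + L x.
  by move=> h; rewrite hL ej.
split.
  by move=> x _; rewrite (derive_comp_line f (E x)); exact: derivable0.
have -> : (fun x => 'D_(delta_mx 0 j) (f \o L) x) = cst 0.
  by apply/funext => x; rewrite (derive_comp_line f (E x)) derive0.
exact: Ck_cst.
Qed.

Variables (m : nat) (U : set 'rV[R]_m).
Hypothesis oU : open U.
Implicit Types (f g : 'rV[R]_m -> R) (k : nat).

Lemma open_near_eq f g x :
  (forall y, U y -> f y = g y) -> U x -> \near x, f x = g x.
Proof.
by move=> fg Ux; apply: filterS (open_nbhs_nbhs (conj oU Ux)) => y; exact: fg.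
Qed.

Lemma eq_Ck k f g : (forall x, U x -> f x = g x) -> Ck k U f -> Ck k U g.
Proof.
have cont f' g' : (forall x, U x -> f' x = g' x) ->
    (forall x, U x -> {for x, continuous f'}) ->
    forall x, U x -> {for x, continuous g'}.
  move=> fg cf x Ux; rewrite /prop_for /continuous_at -(fg x Ux).
  have /near_eq_cvg gf := open_near_eq fg Ux.
  exact: cvg_trans gf (cf x Ux).
elim: k f g => [|k IH] f g fg [cf Df]; split=> //; try exact: cont fg cf.
move=> j; split=> [x Ux|].
  by apply: near_eq_derivable ((Df j).1 x Ux); exact: open_near_eq fg Ux.
apply: IH (Df j).2 => x Ux; apply: near_eq_derive; exact: open_near_eq fg Ux.
Qed.

Lemma CkS k f : Ck k.+1 U f -> Ck k U f.
Proof.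
elim: k f => [|k IH] f [cf Df]; split=> // j.
by split; [exact: (Df j).1|apply: IH; exact: (Df j).2].
Qed.

Lemma CkD k f g : Ck k U f -> Ck k U g -> Ck k U (f + g).
Proof.
elim: k f g => [|k IH] f g [cf Df] [cg Dg]; split=> //.
- by move=> x Ux; apply: continuousD; [exact: cf|exact: cg].
- by move=> x Ux; apply: continuousD; [exact: cf|exact: cg].
move=> j; split.
  by move=> x Ux; apply: derivableD; [exact: (Df j).1|exact: (Dg j).1].
apply: eq_Ck (IH _ _ (Df j).2 (Dg j).2) => x Ux.
by rewrite deriveD //; [exact: (Df j).1|exact: (Dg j).1].
Qed.

Lemma CkM k f g : Ck k U f -> Ck k U g -> Ck k U (f * g).
Proof.
elim: k f g => [|k IH] f g Cf Cg; have [cf Df] := Cf; have [cg Dg] := Cg.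
  by split=> // x Ux; apply: continuousM; [exact: cf|exact: cg].
split=> [x Ux|j]; first by apply: continuousM; [exact: cf|exact: cg].
split.
  by move=> x Ux; apply: derivableM; [exact: (Df j).1|exact: (Dg j).1].
apply: eq_Ck (CkD (IH _ _ (CkS Cf) (Dg j).2) (IH _ _ (CkS Cg) (Df j).2)) => x Ux.
by rewrite deriveM //; [exact: (Df j).1|exact: (Dg j).1].
Qed.

End SmoothFunctions.

(** * Smooth functions in a chart *)

Section ChartCalculus.
Variables (R : realType) (M : Type) (m : nat) (A : atlas R M m).

(** What computations in a single chart use of a manifold. It depends on the
    atlas alone, and so passes to the product with the line, which is given by
    its atlas. *)
Definition local_coordinates : Prop :=
  (forall c : chart A, open (coord c @` dom c)) /\
  (forall (c : chart A) p, dom c p -> cinv c (coord c p) = p).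

Hypothesis hA : local_coordinates.
Implicit Types (c d : chart A) (f g : M -> R) (X Y : vcomp A) (F : mcomp A).

Let chart_eq c f g (fg : forall q, dom c q -> f q = g q) x :
  (coord c @` dom c) x -> (f \o cinv c) x = (g \o cinv c) x.
Proof. by case=> q cq <- /=; rewrite hA.2 // fg. Qed.

(** Components of fields are meaningful on the domain of the chart only, and it is
    there that identities such as [eta xi = 1] are given; openness of the image
    of the chart is what allows one to differentiate them. *)
Lemma eq_pd c j f g p : (forall q, dom c q -> f q = g q) -> dom c p ->
  pd c j f p = pd c j g p.
Proof.
move=> fg cp; apply: near_eq_derive.
by apply: (open_near_eq (hA.1 c)) (chart_eq fg) _; exists p.
Qed.

Lemma eq_smooth_in c f g : (forall q, dom c q -> f q = g q) ->
  smooth_in c f -> smooth_in c g.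
Proof. by move=> fg sf k; apply: (eq_Ck (hA.1 c)) (chart_eq fg) (sf k). Qed.

Lemma smooth_in_cst c (a : R) : smooth_in c (cst a).
Proof. by move=> k; exact: Ck_cst. Qed.

Lemma smooth_inD c f g :
  smooth_in c f -> smooth_in c g -> smooth_in c (fun p => f p + g p).
Proof. by move=> sf sg k; exact: CkD (hA.1 c) _ _ _ (sf k) (sg k). Qed.

Lemma smooth_inM c f g :
  smooth_in c f -> smooth_in c g -> smooth_in c (fun p => f p * g p).
Proof. by move=> sf sg k; exact: CkM (hA.1 c) _ _ _ (sf k) (sg k). Qed.

Lemma smooth_inN c f : smooth_in c f -> smooth_in c (fun p => - f p).
Proof.
move=> sf; apply: eq_smooth_in (smooth_inM (smooth_in_cst c (-1)) sf) => q _ /=.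
by rewrite mulN1r.
Qed.

Lemma smooth_in_sum c n (f : 'I_n -> M -> R) :
  (forall i, smooth_in c (f i)) -> smooth_in c (fun p => \sum_i f i p).
Proof.
elim: n f => [|n IH] f sf.
  by apply: eq_smooth_in (smooth_in_cst c 0) => q _; rewrite big_ord0.
apply: eq_smooth_in (smooth_inD (sf ord0) (IH (fun i => f (lift ord0 i)) _)).
  by move=> q _; rewrite big_ord_recl.
by move=> i; exact: sf.
Qed.

Lemma smooth_in_derivable c f p j : smooth_in c f -> dom c p ->
  derivable (f \o cinv c) (coord c p) (delta_mx 0 j).
Proof. by move=> sf cp; apply: ((sf 1).2 j).1; exists p. Qed.

Lemma pd_cst c j (a : R) p : pd c j (fun=> a) p = 0.
Proof. exact: derive_cst. Qed.

Lemma pdN c j f p : smooth_in c f -> dom c p ->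
  pd c j (fun q => - f q) p = - pd c j f p.
Proof. by move=> sf cp; apply: deriveN; exact: smooth_in_derivable. Qed.

Lemma pd_sumM c j n (f g : 'I_n -> M -> R) p :
  (forall i, smooth_in c (f i)) -> (forall i, smooth_in c (g i)) -> dom c p ->
  pd c j (fun q => \sum_i f i q * g i q) p =
  \sum_i (pd c j (f i) p * g i p + f i p * pd c j (g i) p).
Proof.
move=> sf sg cp; rewrite /pd.
have -> : (fun q => \sum_i f i q * g i q) \o cinv c =
          \sum_i ((f i \o cinv c) * (g i \o cinv c)).
  by apply/funext => x; rewrite fct_sumE.
rewrite derive_sum; last first.
  by move=> i; apply: derivableM; exact: smooth_in_derivable.
apply: eq_bigr => i _; rewrite deriveM; try exact: smooth_in_derivable.
by rewrite /= !hA.2 // /GRing.scale /= addrC [X in X + _]mulrC.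
Qed.

(** * The Lie bracket and the Nijenhuis tensor in a chart *)

Lemma eq_lie X X' Y Y' c p :
  (forall q, dom c q -> X c q = X' c q) ->
  (forall q, dom c q -> Y c q = Y' c q) -> dom c p ->
  lie X Y c p = lie X' Y' c p.
Proof.
move=> XX' YY' cp; apply/rowP => k; rewrite !mxE /dirder.
by congr (_ - _); apply: eq_bigr => j _; rewrite ?XX' ?YY' //;
  congr (_ * _); apply: eq_pd => // q cq; rewrite ?XX' ?YY'.
Qed.

Lemma lie_antisym X Y c p : lie Y X c p = - lie X Y c p.
Proof. by apply/rowP => k; rewrite !mxE opprB. Qed.

Lemma liexx X c p : lie X X c p = 0.
Proof. by apply/rowP => k; rewrite !mxE subrr. Qed.

Lemma lie0r X c p : lie X (fun _ _ => 0) c p = 0.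
Proof.
apply/rowP => k; rewrite !mxE /dirder !big1 ?subrr // => j _.
  by rewrite mxE mul0r.
by rewrite pd_cst mulr0.
Qed.

Lemma lieNr X Y c p : (forall j, smooth_in c (fun q => Y c q 0 j)) ->
  dom c p -> lie X (fun c q => - Y c q) c p = - lie X Y c p.
Proof.
move=> sY cp; apply/rowP => k.
have pdNY j :
    pd c j (fun q => (- Y c q) 0 k) p = - pd c j (fun q => Y c q 0 k) p.
  by rewrite -(pdN _ (sY k) cp); apply: eq_pd cp => q _; rewrite mxE.
rewrite !mxE opprB /dirder addrC -!sumrN.
congr (_ + _); apply: eq_bigr => j _; first by rewrite mxE mulNr opprK.
by rewrite pdNY mulrN.
Qed.

Definition jacobian X c p : 'M[R]_m :=
  \matrix_(j, k) pd c j (fun q => X c q 0 k) p.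

(** The derivative of [q |-> v *m F q] for a constant row [v]. *)
Definition endo_jacobian F c p (v : 'rV[R]_m) : 'M[R]_m :=
  \matrix_(j, k) \sum_i v 0 i * pd c j (fun q => F c q i k) p.

Lemma lieE X Y c p :
  lie X Y c p = X c p *m jacobian Y c p - Y c p *m jacobian X c p.
Proof.
apply/rowP => k; rewrite !mxE /dirder.
by congr (_ - _); apply: eq_bigr => j _; rewrite mxE.
Qed.

Lemma jacobian_app F X c p :
  (forall j, smooth_in c (fun q => X c q 0 j)) ->
  (forall i j, smooth_in c (fun q => F c q i j)) -> dom c p ->
  jacobian (app_endo F X) c p =
  jacobian X c p *m F c p + endo_jacobian F c p (X c p).
Proof.
move=> sX sF cp; apply/matrixP => j k; rewrite !mxE -big_split /=.
rewrite (_ : (fun q => _) = (fun q => \sum_i X c q 0 i * F c q i k)).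
  by rewrite pd_sumM //; apply: eq_bigr => i _; rewrite mxE.
by apply/funext => q; rewrite mxE.
Qed.

(* Rewriting with [mxE] instead would also unfold the matrix products. *)
Let addE (u v : 'rV[R]_m) k : (u + v) 0 k = u 0 k + v 0 k.
Proof. by rewrite mxE. Qed.
Let oppE (u : 'rV[R]_m) k : (- u) 0 k = - u 0 k.
Proof. by rewrite mxE. Qed.
Let scaleE (a : R) (u : 'rV[R]_m) k : (a *: u) 0 k = a * u 0 k.
Proof. by rewrite mxE. Qed.

(** The Nijenhuis tensor as a bilinear map on the tangent space. *)
Definition nijenhuis_at F c p (u v : 'rV[R]_m) : 'rV[R]_m :=
  u *m F c p *m endo_jacobian F c p v - v *m F c p *m endo_jacobian F c p u
  + v *m endo_jacobian F c p u *m F c p - u *m endo_jacobian F c p v *m F c p.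

(** Tensoriality: by the product rule the derivatives of [X] and [Y] cancel, and
    only those of the coefficients of [F] survive. *)
Lemma nijenhuisE F X Y c p :
  (forall j, smooth_in c (fun q => X c q 0 j)) ->
  (forall j, smooth_in c (fun q => Y c q 0 j)) ->
  (forall i j, smooth_in c (fun q => F c q i j)) -> dom c p ->
  nijenhuis F X Y c p = nijenhuis_at F c p (X c p) (Y c p).
Proof.
move=> sX sY sF cp; rewrite /nijenhuis /nijenhuis_at {2 5}/app_endo.
rewrite /app_endo -/(app_endo F X) -/(app_endo F Y) !lieE !jacobian_app //.
rewrite /app_endo !mulmxBl !mulmxDr !mulmxDl ?mulmxBl !mulmxA.
apply/rowP => k; rewrite !(addE, oppE).
by do !move: ((_ *m _) 0 k) => ?; ring.
Qed.

Lemma endo_jacobianD F c p (a : R) u v :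
  endo_jacobian F c p (a *: u + v) =
  a *: endo_jacobian F c p u + endo_jacobian F c p v.
Proof.
apply/matrixP => j k; rewrite !mxE big_distrr -big_split /=.
by apply: eq_bigr => i _; rewrite !mxE mulrDl mulrA.
Qed.

Lemma nijenhuis_at_antisym F c p u v :
  nijenhuis_at F c p v u = - nijenhuis_at F c p u v.
Proof.
by rewrite /nijenhuis_at; apply/rowP => k; rewrite !(addE, oppE); ring.
Qed.

Lemma nijenhuis_at_linear F c p (a : R) u u' v :
  nijenhuis_at F c p (a *: u + u') v =
  a *: nijenhuis_at F c p u v + nijenhuis_at F c p u' v.
Proof.
rewrite /nijenhuis_at endo_jacobianD !(mulmxDr, mulmxDl).
rewrite -!(scalemxAl, scalemxAr).
by apply/rowP => k; rewrite !(addE, oppE, scaleE); ring.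
Qed.

End ChartCalculus.

(** * The product with the real line *)

Section ProductWithLine.
Variables (R : realType) (M : Type) (m : nat) (A : atlas R M m).
Hypothesis hA : local_coordinates A.
Local Notation PA := (prodR_atlas A).
Implicit Types (c d : chart A) (f : M -> R) (X Y : vcomp A) (q : M * R).

Let split_lshift (j : 'I_m) : fintype.split (lshift 1 j) = inl j.
Proof. exact: (unsplitK (inl j)). Qed.

Let split_rshift (j : 'I_1) : fintype.split (rshift m j) = inr j.
Proof. exact: (unsplitK (inr j)). Qed.

Let continuous_row_mx (t : R) :
  continuous (fun x : 'rV[R]_m => row_mx x t%:M : 'rV[R]_(m + 1)).
Proof.
move=> u B /nbhs_ballP[e /= e0 eB].
apply/nbhs_ballP; exists e => //= v [_ uv]; apply: eB; split=> // i j.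
rewrite !mxE; case: (fintype.split j) => [j'|j'] /=; first exact: uv.
by rewrite /ball /= subrr normr0.
Qed.

Let lsubmx_lines j (x : 'rV[R]_(m + 1)) (h : R) :
  lsubmx (h *: delta_mx 0 j + x) =
  h *: (if fintype.split j is inl i then delta_mx 0 i else 0) + lsubmx x.
Proof.
apply/rowP => i; rewrite !mxE; case: split_ordP => j' -> /=; rewrite !mxE.
  by rewrite eq_lshift.
by rewrite eq_lrshift.
Qed.

Let row_mx_lines (t : R) (j : 'I_m) x (h : R) :
  row_mx (h *: delta_mx 0 j + x) t%:M =
  h *: delta_mx 0 (lshift 1 j) + row_mx x t%:M :> 'rV[R]_(m + 1).
Proof.
apply/rowP => i; rewrite !mxE; case: split_ordP => i' ->; rewrite !mxE ?eqxx /=.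
  by rewrite eq_lshift.
by rewrite eq_rlshift mulr0 add0r.
Qed.

Lemma image_prodR c (x : 'rV[R]_(m + 1)) :
  (@coord _ _ _ PA c @` dom (a := PA) c) x <->
  (coord (a := A) c @` dom (a := A) c) (lsubmx x).
Proof.
split=> [[q cq <-]|[p cp px]]; first by exists q.1; rewrite ?row_mxKl.
exists (p, rsubmx x 0 0) => //=; rewrite px -[RHS]hsubmxK; congr row_mx.
by rewrite -mx11_scalar.
Qed.

Lemma local_coordinates_prodR : local_coordinates PA.
Proof.
split=> [c|c [p t] cp /=]; last first.
  by rewrite row_mxKl row_mxKr hA.2 // mxE eqxx mulr1n.
have -> : coord (a := PA) c @` dom (a := PA) c =
    (@lsubmx _ 1 m 1) @^-1` (coord (a := A) c @` dom (a := A) c).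
  by apply/seteqP; split=> x /image_prodR.
by apply: open_comp (hA.1 c) => x _; exact: continuous_lsubmx.
Qed.

Lemma smooth_in_fst c f :
  smooth_in c f -> smooth_in (A := PA) c (fun q => f q.1).
Proof.
move=> sf k.
apply: (@Ck_comp_lines _ _ _ lsubmx k _ (coord (a := A) c @` dom (a := A) c) _
         (fun j => if fintype.split j is inl i then Some i else None)) (sf k).
- exact: continuous_lsubmx.
- by move=> j x h; rewrite lsubmx_lines; case: (fintype.split j).
- by move=> x /image_prodR.
Qed.

Lemma smooth_in_slice c (f : M * R -> R) (t : R) :
  smooth_in (A := PA) c f -> smooth_in c (fun p => f (p, t)).
Proof.
move=> sf k.
have -> : (fun p => f (p, t)) \o cinv c =
    (f \o cinv (a := PA) c) \o (fun x => row_mx x t%:M).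
  by apply/funext => x /=; rewrite row_mxKl row_mxKr mxE eqxx mulr1n.
apply: (@Ck_comp_lines _ _ _ _ k _ _ _ (fun j => Some (lshift 1 j))) (sf k).
- exact: continuous_row_mx.
- by move=> j x h; rewrite row_mx_lines.
- by move=> x xU; apply/image_prodR; rewrite row_mxKl.
Qed.

Lemma pd_fst c (j : 'I_(m + 1)) f q :
  pd (A := PA) c j (fun q => f q.1) q =
  if fintype.split j is inl i then pd c i f q.1 else 0.
Proof.
have := derive_comp_line (f \o cinv c) (lsubmx_lines j (coord (a := PA) c q)).
move=> [+ _]; rewrite /pd /= row_mxKl => ->.
by case: (fintype.split j) => [i|i] //; rewrite derive0.
Qed.

Lemma pd_snd c (j : 'I_(m + 1)) q :
  pd (A := PA) c j snd q = (if fintype.split j is inr _ then 1 else 0).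
Proof.
have lines (x : 'rV[R]_(m + 1)) (h : R) : rsubmx (h *: delta_mx 0 j + x) 0 0 =
    h *: (if fintype.split j is inr _ then 1 else 0) + rsubmx x 0 0.
  rewrite !mxE; case: split_ordP => i ->; rewrite ?eq_rlshift ?eq_rshift //.
  by rewrite ord1 eqxx.
have [+ _] := @derive_comp_line R 'rV[R]_(m + 1) R (fun x => rsubmx x 0 0) id
  _ _ _ (lines (coord (a := PA) c q)).
by rewrite derive_id.
Qed.

Lemma jac_prodR c d q :
  jac (A := PA) c d q = block_mx (jac c d q.1) 0 0 1%:M.
Proof.
apply/matrixP => j k; rewrite !mxE.
case: (split_ordP k) => k' ->.
  rewrite (_ : (fun q => _) = fun q => coord (a := A) d q.1 0 k'); last first.
    by apply/funext => q' /=; rewrite row_mxEl.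
  rewrite (pd_fst c j (fun p => coord (a := A) d p 0 k')).
  by case: fintype.split => i; rewrite row_mxEl ?mxE.
rewrite (_ : (fun q => _) = snd); last first.
  by apply/funext => q' /=; rewrite row_mxEr ord1 mxE eqxx mulr1n.
rewrite pd_snd; case: fintype.split => i; rewrite row_mxEr ?mxE //.
by rewrite !ord1 eqxx.
Qed.

(** The field [(X, a d/dt)]. Constant [a] suffice: for a section [X] of
    [Ker eta] and for [xi] and [d/dt], the images under the almost complex
    structure are again of this form, whence [lie_lift] computes every bracket.
*)
Definition lift_field X (a : R) : vcomp PA := fun c q => row_mx (X c q.1) a%:M.

Lemma vector_field_lift X a : vector_field X -> vector_field (lift_field X a).
Proof.
move=> [sX tX]; split=> [c j|c d q cq dq].
  case: (split_ordP j) => i ->.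
    rewrite (_ : (fun q => _) = fun q => X c q.1 0 i).
      exact: (smooth_in_fst (sX c i)).
    by apply/funext => q; rewrite row_mxEl.
  rewrite (_ : (fun q => _) = cst (a%:M 0 i)); first exact: smooth_in_cst.
  by apply/funext => q; rewrite row_mxEr.
rewrite jac_prodR mul_row_block !mulmx0 addr0 add0r mulmx1 /lift_field.
by rewrite (tX c d).
Qed.

(** This is how global fields on [M] are obtained, without partitions of unity:
    the Jacobian of a change of charts of the product is block diagonal and does
    not depend on the last coordinate. *)
Lemma vector_field_slice (X : vcomp PA) (t : R) : vector_field X ->
  vector_field (fun c p => lsubmx (X c (p, t)) : 'rV[R]_m).
Proof.
move=> [sX tX]; split=> [c j|c d p cp dp].
  rewrite (_ : (fun p => _) = fun p => X c (p, t) 0 (lshift 1 j)).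
    exact: smooth_in_slice (sX c _).
  by apply/funext => p; rewrite mxE.
rewrite (tX c d) // jac_prodR -{1}[X c (p, t)]hsubmxK.
by rewrite mul_row_block mulmx0 addr0 row_mxKl.
Qed.

Lemma lie_lift X Y (a b : R) c q :
  lie (lift_field X a) (lift_field Y b) c q = lift_field (lie X Y) 0 c q.
Proof.
have dir (Z W : vcomp A) (e e' : R) (k : 'I_(m + 1)) :
  dirder (lift_field Z e) c (fun q' => lift_field W e' c q' 0 k) q =
  if fintype.split k is inl i then dirder Z c (fun p => W c p 0 i) q.1 else 0.
  case: (split_ordP k) => i ->; last first.
    rewrite /dirder big1 // => j _.
    rewrite (_ : (fun q => _) = fun=> e'%:M 0 i) ?pd_cst ?mulr0 //.
    by apply/funext => q'; rewrite row_mxEr.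
  have pdW j :
      pd (A := PA) c j (fun q' => lift_field W e' c q' 0 (lshift 1 i)) q =
      if fintype.split j is inl j' then pd c j' (fun p => W c p 0 i) q.1 else 0.
    rewrite -(pd_fst c j (fun p => W c p 0 i)).
    by congr (pd _ _ _ _); apply/funext => q'; rewrite row_mxEl.
  rewrite /dirder big_split_ord /= big_ord1 pdW.
  rewrite split_rshift mulr0 addr0; apply: eq_bigr => j _.
  by rewrite pdW split_lshift row_mxEl.
apply/rowP => k; rewrite !mxE !dir; case: split_ordP => i _ /=.
  by rewrite !mxE.
by rewrite !mxE subrr mul0rn.
Qed.

End ProductWithLine.

(** * Constructions of global vector fields *)

Section VectorFields.
Variables (R : realType) (M : Type) (m : nat) (A : atlas R M m).
Hypothesis hA : local_coordinates A.
Implicit Types (X Y : vcomp A).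

Lemma vector_field0 : vector_field ((fun _ _ => 0) : vcomp A).
Proof.
split=> [c j|c d p _ _]; last by rewrite mul0mx.
rewrite (_ : (fun p => _) = cst 0); first exact: smooth_in_cst.
by apply/funext => p; rewrite mxE.
Qed.

Lemma vector_field_app (F : mcomp A) X :
  endo_field F -> vector_field X -> vector_field (app_endo F X).
Proof.
move=> [sF tF] [sX tX]; split=> [c j|c d p cp dp].
  rewrite (_ : (fun p => _) = fun p => \sum_i X c p 0 i * F c p i j).
    by apply: smooth_in_sum => // i; apply: smooth_inM.
  by apply/funext => p; rewrite mxE.
by rewrite /app_endo (tX c d) // -mulmxA -tF // mulmxA.
Qed.

(** With [a = eta] and [Y = xi] this projects a field to a section of
    [Ker eta]. *)
Lemma vector_fieldB_form (a : fcomp A) X Y :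
  one_form a -> vector_field X -> vector_field Y ->
  vector_field (fun c p => X c p - appl (a c p) (X c p) *: Y c p).
Proof.
move=> [sa ta] [sX tX] [sY tY]; split=> [c j|c d p cp dp].
  rewrite (_ : (fun p => _) =
      fun p => X c p 0 j + - ((\sum_i X c p 0 i * a c p i 0) * Y c p 0 j)).
    have seta : smooth_in c (fun p => \sum_i X c p 0 i * a c p i 0).
      by apply: (smooth_in_sum hA) => i; exact: smooth_inM.
    have sY' := smooth_inN hA (smooth_inM hA seta (sY c j)).
    exact: (smooth_inD hA (sX c j) sY').
  by apply/funext => p; rewrite /appl !mxE.
by rewrite mulmxBl -scalemxAl (tX c d) // (tY c d) // (ta c d) // /appl mulmxA.
Qed.

End VectorFields.

(** * Contact structures and the Bott connection *)

Section Contact.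
Variables (R : realType) (M : Type) (m : nat) (A : atlas R M m).
Hypothesis hA : local_coordinates A.
Variables (eps : R) (phi : mcomp A) (xi : vcomp A) (eta : fcomp A) (g : mcomp A).
Hypothesis hcontact : contact_pseudo_metric eps phi xi eta g.
Implicit Types (X Y : vcomp A) (c : chart A).
Local Notation H := (ker_form eta).
Local Notation J := (prodR_J phi xi eta).
Local Notation ddt := (lift_field ((fun _ _ => 0) : vcomp A) 1).

Let ac := cm_almost hcontact.

Let etaD c p v w : appl (eta c p) (v + w) = appl (eta c p) v + appl (eta c p) w.
Proof. by rewrite /appl mulmxDl mxE. Qed.
Let etaN c p v : appl (eta c p) (- v) = - appl (eta c p) v.
Proof. by rewrite /appl mulNmx mxE. Qed.
Let etaZ c p a v : appl (eta c p) (a *: v) = a * appl (eta c p) v.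
Proof. by rewrite /appl -scalemxAl mxE. Qed.
Let eta0 c p : appl (eta c p) 0 = 0.
Proof. by rewrite /appl mul0mx mxE. Qed.
Let formDr (G : 'M[R]_m) u v w : form G u (v + w) = form G u v + form G u w.
Proof. by rewrite /form linearD mulmxDr mxE. Qed.
Let formZr (G : 'M[R]_m) a u v : form G u (a *: v) = a * form G u v.
Proof. by rewrite /form linearZ -scalemxAr mxE. Qed.
Let form0r (G : 'M[R]_m) u : form G u 0 = 0.
Proof. by rewrite -(scale0r 0) formZr mul0r. Qed.
Let formBl (G : 'M[R]_m) u v w : form G (u - v) w = form G u w - form G v w.
Proof. by rewrite /form !mulmxBl !mxE. Qed.
Let form0l (G : 'M[R]_m) u : form G 0 u = 0.
Proof. by rewrite /form !mul0mx mxE. Qed.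

Let scalar0 : (0 : R)%:M = 0 :> 'M[R]_1.
Proof. by rewrite -scalemx1 scale0r. Qed.
Let row_eq0 (u : 'rV[R]_m) (a : R) : row_mx u a%:M = 0 -> u = 0 /\ a = 0.
Proof.
rewrite -row_mx0 => /eq_row_mx[-> /(congr1 (fun B : 'M[R]_1 => B 0 0))].
by rewrite !mxE eqxx mulr1n.
Qed.

(** Compatibility of [g] with [phi], applied to [v] and [xi], as [phi xi = 0]. *)
Lemma form_xi c p v : dom c p ->
  form (g c p) v (xi c p) = eps * appl (eta c p) v.
Proof.
move=> cp; have := ac_compat ac cp v (xi c p).
rewrite (ac_phi_xi ac cp) form0r (ac_eta_xi ac cp) mulr1 => /esym/eqP.
by rewrite subr_eq0 => /eqP.
Qed.

(** The form [g] is nondegenerate on [Ker eta], because [Ker eta] and [xi] are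
    orthogonal and span the tangent space. *)
Lemma orth_ker_eq0 c p u : dom c p -> appl (eta c p) u = 0 ->
  (forall w, appl (eta c p) w = 0 -> form (g c p) u w = 0) -> u = 0.
Proof.
move=> cp u0 uH; apply: (pr_nondeg (ac_g ac) cp) => w.
rewrite -[w](subrK (appl (eta c p) w *: xi c p)) formDr formZr form_xi // u0.
rewrite !mulr0 addr0 uH // etaD etaN etaZ (ac_eta_xi ac cp).
by rewrite mulr1 subrr.
Qed.

Lemma orth_proj_ker c p v : dom c p -> appl (eta c p) v = 0 ->
  orth_proj (g c p) (H c p) v = v.
Proof.
move=> cp v0; apply: xget_subset1 => [|z z' [/= z0 zv] [/= z'0 z'v]].
  by split=> // w _; rewrite subrr form0l.
apply/eqP; rewrite -subr_eq0; apply/eqP; apply: (orth_ker_eq0 cp).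
  by rewrite etaD etaN z0 z'0 subrr.
move=> w w0; have -> : z - z' = (v - z') - (v - z).
  by rewrite opprB [RHS]addrC addrA subrK.
by rewrite formBl zv // z'v // subrr.
Qed.

(** Evaluate [d eta = g(-, phi -)] on [xi] and [X]: the functions [eta X] and
    [eta xi] are constant, and [g(xi, phi X)] is a multiple of [eta (phi X)]. *)
Lemma eta_lie_xi X c p : section_of H X -> dom c p ->
  appl (eta c p) (lie xi X c p) = 0.
Proof.
move=> [vX HX] cp; have := cm_contact hcontact (ac_xi ac) vX cp.
rewrite (pr_sym (ac_g ac) cp) form_xi // (ac_eta_phi ac cp) mulr0 /ext_d.
have dir0 Z f (a : R) : (forall q, dom c q -> f q = a) -> dirder Z c f p = 0.
  move=> fa; rewrite /dirder big1 // => j _.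
  by rewrite (eq_pd hA j (g := fun=> a)) // pd_cst mulr0.
rewrite (dir0 _ _ 0); last by move=> q; exact: HX.
rewrite (dir0 _ _ 1); last by move=> q; exact: (ac_eta_xi ac).
rewrite subrr sub0r mulrN => /eqP.
by rewrite oppr_eq0 mulf_eq0 invr_eq0 pnatr_eq0 => /eqP.
Qed.

Lemma section_phi X : vector_field X -> section_of H (app_endo phi X).
Proof.
move=> vX; split; first exact: vector_field_app (ac_phi ac) vX.
by move=> c p cp; exact: (ac_eta_phi ac cp).
Qed.

(** By [eta_lie_xi] the brackets [[xi, X]] and [[xi, phi X]] already lie in
    [Ker eta], hence the projection in the Bott connection does nothing. *)
Lemma bott_parallelE :
  bott_parallel g H xi phi <->
  forall X, section_of H X -> forall c p, dom c p ->
    lie xi (app_endo phi X) c p = lie xi X c p *m phi c p.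
Proof.
have bottE X c p : section_of H X -> dom c p -> bott g H xi X c p = lie xi X c p.
  by move=> hX cp; rewrite /bott orth_proj_ker //; exact: eta_lie_xi.
split=> hb X hX c p cp; have := hb X hX c p cp.
  rewrite /app_endo -/(app_endo phi X) !bottE //; last exact: section_phi hX.1.
  by move/eqP; rewrite subr_eq0 => /eqP.
rewrite /app_endo -/(app_endo phi X) !bottE //; last exact: section_phi hX.1.
by move=> ->; rewrite subrr.
Qed.

(** * The Nijenhuis tensor of the product structure *)

Lemma app_prodR_J X (a : R) c q :
  lift_field X a c q *m J c q =
  row_mx (X c q.1 *m phi c q.1 - a *: xi c q.1) (appl (eta c q.1) (X c q.1))%:M.
Proof.
rewrite /lift_field /prodR_J mul_row_block mulmx0 addr0 mulmxN mul_scalar_mx.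
by rewrite -mx11_scalar.
Qed.

(** For fields whose images under [J] are again lifts, every bracket in the
    Nijenhuis tensor is the lift of a bracket on [M], and [J] squares to [-1]. *)
Lemma nijenhuis_prodR X Y X' Y' (a b a' b' : R) c q : dom c q.1 ->
  (forall q, dom c q.1 -> app_endo J (lift_field X a) c q = lift_field X' a' c q) ->
  (forall q, dom c q.1 -> app_endo J (lift_field Y b) c q = lift_field Y' b' c q) ->
  let S := lie X' Y c q.1 + lie X Y' c q.1 in
  nijenhuis J (lift_field X a) (lift_field Y b) c q =
  row_mx (lie X' Y' c q.1 - lie X Y c q.1 - S *m phi c q.1)
         (- appl (eta c q.1) S)%:M.
Proof.
move=> cq JX JY S.
have lieJ := eq_lie (local_coordinates_prodR hA) _ _ cq.
have -> : nijenhuis J (lift_field X a) (lift_field Y b) c q =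
    lie (app_endo J (lift_field X a)) (app_endo J (lift_field Y b)) c q
    + lie (lift_field X a) (lift_field Y b) c q *m J c q *m J c q
    - lie (app_endo J (lift_field X a)) (lift_field Y b) c q *m J c q
    - lie (lift_field X a) (app_endo J (lift_field Y b)) c q *m J c q by [].
rewrite (lieJ _ _ _ _ JX JY) (lieJ _ _ _ (lift_field Y b) JX) //.
rewrite (lieJ _ (lift_field X a) _ _ _ JY) //.
rewrite !lie_lift !app_prodR_J !scale0r !subr0.
rewrite /prodR_J mul_row_block (ac_phi2 ac cq) mulmxN mul_scalar_mx addrK.
have phi_eta (v : 'rV[R]_m) : v *m phi c q.1 *m eta c q.1 = 0.
  by apply/rowP => k; rewrite ord1 [RHS]mxE; exact: (ac_eta_phi ac cq).
rewrite phi_eta mulmx0 addr0 /lift_field /S {S}.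
move: (lie X' Y' _ _) (lie X Y _ _) (lie X' Y _ _) (lie X Y' _ _) => L1 L0 Sl Sr.
rewrite !opp_row_mx !add_row_mx mulmxDl opprD addrA etaD opprD.
rewrite addr0 scalar0 sub0r.
by rewrite -!raddfN -raddfD.
Qed.

Let smooth_J c i j : smooth_in (A := prodR_atlas A) c (fun q => J c q i j).
Proof.
have [[sphi _] [sxi _] [seta _]] := And3 (ac_phi ac) (ac_xi ac) (ac_eta ac).
have hP := local_coordinates_prodR hA.
case: (split_ordP i) => i' ->; case: (split_ordP j) => j' ->.
- rewrite (_ : (fun q => _) = fun q => phi c q.1 i' j').
    exact: (smooth_in_fst (sphi c i' j')).
  by apply/funext => q; rewrite block_mxEul.
- rewrite (_ : (fun q => _) = fun q => eta c q.1 i' 0).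
    exact: (smooth_in_fst (seta c i')).
  by apply/funext => q; rewrite block_mxEur ord1.
- rewrite (_ : (fun q => _) = fun q => - xi c q.1 0 j').
    exact: (smooth_inN hP (smooth_in_fst (sxi c j'))).
  by apply/funext => q; rewrite block_mxEdl ord1 mxE.
- rewrite (_ : (fun q => _) = cst 0); first exact: smooth_in_cst.
  by apply/funext => q; rewrite block_mxEdr mxE.
Qed.

Let J_section X c : section_of H X -> forall q, dom c q.1 ->
  app_endo J (lift_field X 0) c q = lift_field (app_endo phi X) 0 c q.
Proof. by move=> [_ HX] q cq; rewrite /app_endo app_prodR_J scale0r subr0 HX. Qed.

Let J_xi c q : dom c q.1 -> app_endo J (lift_field xi 0) c q = ddt c q.
Proof.
move=> cq; rewrite /app_endo app_prodR_J scale0r subr0 (ac_phi_xi ac cq).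
by rewrite (ac_eta_xi ac cq).
Qed.

Let J_ddt c q : dom c q.1 ->
  app_endo J ddt c q = lift_field (fun c p => - xi c p) 0 c q.
Proof.
by move=> cq; rewrite /app_endo app_prodR_J mul0mx sub0r scale1r /appl mul0mx mxE.
Qed.

Arguments J_section {X c} _ _ _.
Arguments J_xi {c} _ _.
Arguments J_ddt {c} _ _.

Lemma integrable_CR_bott : integrable_endo J ->
  CR_integrable H phi /\ bott_parallel g H xi phi.
Proof.
move=> hJ; split=> [X Y hX hY c p cp Z|].
  have := hJ _ _ (vector_field_lift 0 hX.1) (vector_field_lift 0 hY.1)
    c (p, 0) cp.
  rewrite (nijenhuis_prodR _ (J_section hX) (J_section hY)) //=.
  move=> /row_eq0[/eqP U V]; split; last by move: U; rewrite subr_eq0 => /eqP.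
  by apply: oppr_inj; rewrite oppr0.
apply/bott_parallelE => X hX c p cp.
have := hJ _ _ (vector_field_lift 0 hX.1) (vector_field_lift 0 (ac_xi ac))
  c (p, 0) cp.
rewrite (nijenhuis_prodR _ (J_section hX) J_xi) //= !lie0r.
move=> /row_eq0[+ _]; rewrite !(lie_antisym xi) addr0 sub0r opprK mulNmx opprK.
(* Applying [phi] to [[xi, X] + phi [xi, phi X] = 0] gives the Bott condition. *)
move=> /(congr1 (mulmx ^~ (phi c p))); rewrite mulmxDl (ac_phi2 ac cp) mul0mx.
rewrite (eta_lie_xi (section_phi hX.1) cp) scale0r addr0 => /eqP.
by rewrite subr_eq0 => /eqP.
Qed.

Lemma CR_bott_integrable : CR_integrable H phi -> bott_parallel g H xi phi ->
  integrable_endo J.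
Proof.
move=> hCR /bott_parallelE hb X Y vX vY c q cq.
have hP := local_coordinates_prodR hA.
have sl Z a j : vector_field Z -> smooth_in c (fun q => lift_field Z a c q 0 j).
  by move=> vZ; exact: (vector_field_lift a vZ).1.
have v0 := vector_field0 A.
pose T := nijenhuis_at J c q.
have TE Z W a b : vector_field Z -> vector_field W ->
    T (lift_field Z a c q) (lift_field W b c q) =
    nijenhuis J (lift_field Z a) (lift_field W b) c q.
  by move=> vZ vW; rewrite nijenhuisE // => j; exact: sl.
have antisym u v : T u v = 0 -> T v u = 0.
  by move=> uv; rewrite /T nijenhuis_at_antisym -/(T u v) uv oppr0.
have HH Z W : section_of H Z -> section_of H W ->
    T (lift_field Z 0 c q) (lift_field W 0 c q) = 0.
  move=> hZ hW; rewrite TE; try by [case: hZ|case: hW].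
  rewrite (nijenhuis_prodR cq (J_section hZ) (J_section hW)) /=.
  have [/= -> ->] := hCR _ _ hZ hW c q.1 cq.
  by rewrite subrr oppr0 scalar0 row_mx0.
have Hxi Z : section_of H Z -> T (lift_field Z 0 c q) (lift_field xi 0 c q) = 0.
  move=> hZ; rewrite TE; try by [case: hZ|exact: ac_xi ac].
  rewrite (nijenhuis_prodR cq (J_section hZ) J_xi) /= !lie0r.
  rewrite !(lie_antisym xi) addr0 sub0r opprK mulNmx opprK hb // (ac_phi2 ac cq).
  rewrite etaN -hb // (eta_lie_xi (section_phi hZ.1) cq) (eta_lie_xi hZ cq).
  by rewrite scale0r addr0 subrr !oppr0 scalar0 row_mx0.
have Hddt Z : section_of H Z -> T (lift_field Z 0 c q) (ddt c q) = 0.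
  move=> hZ; rewrite TE //; try by case: hZ.
  rewrite (nijenhuis_prodR cq (J_section hZ) J_ddt) /= !lie0r.
  rewrite !(lieNr hA _ ((ac_xi ac).1 c) cq) !(lie_antisym xi) !opprK subr0 add0r.
  by rewrite hb // subrr (eta_lie_xi hZ cq) oppr0 scalar0 row_mx0.
have xiddt : T (lift_field xi 0 c q) (ddt c q) = 0.
  rewrite TE //; try exact: ac_xi ac.
  rewrite (nijenhuis_prodR cq J_xi J_ddt) /= !lie0r.
  rewrite !(lieNr hA _ ((ac_xi ac).1 c) cq) liexx (lie_antisym xi) lie0r.
  by rewrite !oppr0 !addr0 mul0mx eta0 !oppr0 addr0 scalar0 row_mx0.
rewrite (nijenhuisE hP (vX.1 c) (vY.1 c)) // -/T.
(* The values at [q] of the fields of the product are spanned by those of the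
   generators: slice, then split off the component along [xi]. *)
have dec (Z : vcomp (prodR_atlas A)) : vector_field Z -> exists a b W,
    section_of H W /\
    Z c q = a *: lift_field xi 0 c q + (b *: ddt c q + lift_field W 0 c q).
  move=> vZ; have vZq := vector_field_slice q.2 vZ.
  set Zq := fun c p => _ in vZq.
  exists (appl (eta c q.1) (Zq c q.1)), (rsubmx (Z c q) 0 0).
  exists (fun c p => Zq c p - appl (eta c p) (Zq c p) *: xi c p); split; first split.
  - exact: vector_fieldB_form (ac_eta ac) vZq (ac_xi ac).
  - move=> d p dp; rewrite /ker_form /= etaD etaN etaZ (ac_eta_xi ac dp).
    by rewrite mulr1 subrr.
  rewrite /lift_field !scale_row_mx !add_row_mx -[LHS]hsubmxK scaler0 add0r.
  congr row_mx; first by rewrite addrC subrK /Zq -surjective_pairing.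
  by rewrite [LHS]mx11_scalar scalar0 scaler0 addr0 add0r scalemx1.
have [a [b [X0 [hX ->]]]] := dec _ vX; have [a' [b' [Y0 [hY ->]]]] := dec _ vY.
have comb al be u v w e : T u e = 0 -> T v e = 0 -> T w e = 0 ->
    T (al *: u + (be *: v + w)) e = 0.
  move=> ue ve we; rewrite /T !nijenhuis_at_linear -!/(T _ _) ue ve we.
  by rewrite !scaler0 !addr0.
have diag u : T u u = 0 by rewrite /T /nijenhuis_at subrr add0r subrr.
apply: (comb); apply: (antisym); apply: (comb).
- exact: diag.
- exact: antisym xiddt.
- exact: Hxi hY.
- exact: xiddt.
- exact: diag.
- exact: Hddt hY.
- exact: antisym (Hxi _ hX).
- exact: antisym (Hddt _ hX).
- exact: HH hY hX.
Qed.

End Contact.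

Theorem theorem6p6 (R : realType) (n : nat) (M : topologicalType)
    (A : atlas R M n.*2.+1) (eps : R) (phi : mcomp A) (xi : vcomp A)
    (eta : fcomp A) (g : mcomp A)
    (hM : smooth_manifold A) (hconn : connected [set: M])
    (hcontact : contact_pseudo_metric eps phi xi eta g) :
  sasakian_pseudo_metric eps phi xi eta g <->
  (CR_integrable (ker_form eta) phi /\
   bott_parallel g (ker_form eta) xi phi).
Proof.
have hA : local_coordinates A.
  by split; [exact: sm_open_img hM|exact: sm_coordK hM].
split=> [[_ hJ]|[hCR hb]]; first exact: (integrable_CR_bott hA hcontact hJ).
by split=> //; exact: (CR_bott_integrable hA hcontact hCR hb).
Qed.
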